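(* Let $\Psi$ be a Følner sequence on $\mathbb{N}$ and let $f\colon\mathbb{N}\to\mathbb{R}$ be a bounded function belonging to $\mathsf{Bes}(\mathbb{N},\Psi)^\perp$. Then for every non-empty Bohr set $B\subset\mathbb{N}$ and every bounded function $h\colon\mathbb{N}\to\mathbb{R}$ the set $$\Big\{\mathfrak{p}\in\mathsf{cl}(B): \limsup_{N\to\infty}\frac{1}{|\Psi_N|}\sum_{m\in\Psi_N}h(m)\,(\mathsf{R}^{\mathfrak{p}}f)(m)\ge0\Big\}$$ is Borel measurable and has positive measure with respect to every $\mu\in\mathcal{M}(\Psi)$.
   Context: A Følner sequence in $\mathbb{N}$ is a sequence $\Psi\colon N\mapsto\Psi_N$ of finite non-empty subsets of $\mathbb{N}$ with $|(\Psi_N+m)\triangle\Psi_N|/|\Psi_N|\to0$ for all $m\in\mathbb{N}$. $\mathsf{Bes}(\mathbb{N},\Psi)^\perp$ is the set of $f$ with $\big(\limsup_N\frac{1}{|\Psi_N|}\sum_{n\in\Psi_N}|f(n)|^2\big)^{1/2}<\infty$ and $\lim_{N}\frac{1}{|\Psi_N|}\sum_{n\in\Psi_N}f(n)e^{2\pi in\theta}=0$ for all $\theta\in[0,1)$. $\beta\mathbb{N}$ is the space of ultrafilters on $\mathbb{N}$ with the topology generated by the sets $\mathsf{cl}(A)=\{\mathfrak{p}:A\in\mathfrak{p}\}$, $A\subset\mathbb{N}$, with $n$ identified with the principal ultrafilter at $n$. For an ultrafilter $\mathfrak{p}$ and bounded $f$, $(\mathsf{R}^{\mathfrak{p}}f)(n)=\lim_{m\to\mathfrak{p}}f(n+m)$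 (ultrafilter limit). $\mathcal{M}(\Psi)$ is the set of Radon probability measures on $\beta\mathbb{N}$ that are weak$^*$ accumulation points of $\{\frac{1}{|\Psi_N|}\sum_{n\in\Psi_N}\delta_n:N\in\mathbb{N}\}$. A Bohr set is a set $a^{-1}(U)$ with $a$ a homomorphism from $(\mathbb{N},+)$ into a compact metrizable abelian group $K$ and $U\subset K$ a non-empty open set whose boundary has zero Haar measure. *)

(* Defs.v *)
From HB Require Import structures.
From mathcomp Require Import all_boot all_order all_algebra finmap.
From mathcomp Require Import all_classical all_reals all_analysis.
Set Implicit Arguments. Unset Strict Implicit. Unset Printing Implicit Defensive.
Import Order.TTheory GRing.Theory Num.Theory.
Import numFieldNormedType.Exports.
Local Open Scope classical_set_scope.
Local Open Scope ring_scope.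

Definition favg (R : realType) (Psi : nat -> {fset nat}) (N : nat)
  (u : nat -> R) : R :=
  (#|` Psi N|%:R)^-1 * \sum_(n <- Psi N) u n.

Definition fshift (A : {fset nat}) (m : nat) : {fset nat} :=
  [fset (n + m)%N | n in A]%fset.

Definition folner (R : realType) (Psi : nat -> {fset nat}) : Prop :=
  (forall N, Psi N != fset0) /\
  forall m : nat,
    (fun N => (#|` ((fshift (Psi N) m `\` Psi N) `|`
                    (Psi N `\` fshift (Psi N) m))%fset|%:R
               / (#|` Psi N|%:R) : R)) @ \oo --> (0 : R).

Definition bounded_seq (R : realType) (f : nat -> R) : Prop :=
  exists M : R, forall n, `|f n| <= M.

(* Bes(N,Psi)^perp for a real-valued f: the complex averages of
   f(n) e^{2 pi i n theta} tend to 0, written via real and imaginary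
   parts. *)
Definition bes_perp (R : realType) (Psi : nat -> {fset nat}) (f : nat -> R)
  : Prop :=
  (limn_esup (fun N => (favg Psi N (fun n => `|f n| ^+ 2))%:E) < +oo)%E /\
  forall theta : R, 0 <= theta < 1 ->
    (fun N => favg Psi N (fun n => f n * cos (2 * pi * n%:R * theta)))
      @ \oo --> (0 : R) /\
    (fun N => favg Psi N (fun n => f n * sin (2 * pi * n%:R * theta)))
      @ \oo --> (0 : R).

Definition betaN : Type := {F : set_system nat | inhabited (UltraFilter F)}.
HB.instance Definition _ := gen_eqMixin betaN.
HB.instance Definition _ := gen_choiceMixin betaN.

Definition principal_uf (n : nat) : betaN :=
  exist _ (principal_filter n) (inhabits (principal_filter_ultra n)).
HB.instance Definition _ := isPointed.Build betaN (principal_uf 0).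

Definition clN (A : set nat) : set betaN := [set p | sval p A].

Lemma clN_cover : \bigcup_(A in [set: set nat]) clN A = [set: betaN].
Proof.
apply/seteqP; split => // p _; exists setT => //.
case: p => F [UF] /=; rewrite /clN /=; exact: filterT.
Qed.

Lemma clN_join (A B : set nat) (p : betaN) :
  [set: set nat] A -> [set: set nat] B -> clN A p -> clN B p ->
  exists C, [/\ [set: set nat] C, clN C p & clN C `<=` clN A `&` clN B].
Proof.
move=> _ _; case: p => F [UF] /=; rewrite /clN /= => FA FB.
exists (A `&` B); split => //; first exact: filterI.
move=> [G [UG]] /= GAB; split => /=.
  by apply: filterS GAB => x [].
by apply: filterS GAB => x [].
Qed.

HB.instance Definition _ := isBaseTopological.Build betaN clN_cover clN_join.

Definition betaN_borel : Type := g_sigma_algebraType (@open betaN).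

Definition ulim (R : realType) (p : betaN) (u : nat -> R) : R :=
  lim (u @ (sval p)).

Definition Rshift (R : realType) (p : betaN) (f : nat -> R) (n : nat) : R :=
  ulim p (fun m => f (n + m)%N).

Definition radon (R : realType) (T : topologicalType) (mu : set T -> \bar R)
  : Prop :=
  [/\ forall x : T, exists U : set T, [/\ open U, U x & (mu U < +oo)%E],
      forall A : set T, <<s (@open T) >> A ->
        mu A = ereal_inf [set mu U | U in [set U : set T | open U /\ A `<=` U]] &
      forall U : set T, open U ->
        mu U = ereal_sup [set mu C | C in [set C : set T | compact C /\ C `<=` U]]].

(* M(Psi): Radon probability measures on beta N which are weak-* cluster
   points of the sequence N |-> (1/|Psi_N|) sum_{n in Psi_N} delta_n.
   A basic weak-* neighbourhood of mu is given by finitely many continuous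
   functions g_0..g_{k-1} : beta N -> R and eps > 0. *)
Definition in_MPsi (R : realType) (Psi : nat -> {fset nat})
  (mu : probability betaN_borel R) : Prop :=
  radon (mu : set betaN -> \bar R) /\
  forall (k : nat) (gs : 'I_k -> betaN -> R),
    (forall i, continuous (gs i)) ->
    forall eps : R, 0 < eps -> forall N0 : nat,
    exists2 N : nat, (N0 <= N)%N &
      forall i : 'I_k,
        `| fine (\int[mu]_(x in [set: betaN_borel]) ((gs i x)%:E))
           - favg Psi N (fun n => gs i (principal_uf n)) | < eps.

(* a pointed copy of a topological abelian group (needed to form the
   measurable type of Borel sets) *)
Section pointed_copy.
Variable K : topologicalZmodType.
Definition zpointed : Type := K.
HB.instance Definition _ := Choice.on zpointed.
HB.instance Definition _ := isPointed.Build zpointed 0.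
Definition zborel : set (set zpointed) := @open K.
End pointed_copy.

Definition metrizable (R : realType) (T : topologicalType) : Prop :=
  exists d : T -> T -> R,
    [/\ (forall x y, d x y = 0 <-> x = y),
        (forall x y, d x y = d y x),
        (forall x y z, d x z <= d x y + d y z) &
        (forall A : set T, open A <->
          (forall x, A x -> exists2 e : R, 0 < e & [set y | d x y < e] `<=` A))].

Definition haar (R : realType) (K : topologicalZmodType)
  (lam : probability (g_sigma_algebraType (@zborel K)) R) : Prop :=
  radon (lam : set K -> \bar R) /\
  forall (x : K) (A : set K), <<s (@open K) >> A ->
    lam [set x + y | y in A] = lam A.

Definition bohr_set (R : realType) (B : set nat) : Prop :=
  exists (K : topologicalZmodType) (a : nat -> K) (U : set K)
         (lam : probability (g_sigma_algebraType (@zborel K)) R),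
    [/\ compact [set: K], metrizable R K,
         (forall m n : nat, a (m + n)%N = a m + a n) & haar lam] /\
    [/\ open U, U !=set0, lam (closure U `\` interior U) = 0%E &
         B = a @^-1` U].

(* Main.v *)
Require Import Defs.
From HB Require Import structures.
From mathcomp Require Import all_boot all_order all_algebra finmap.
From mathcomp Require Import all_classical all_reals all_analysis measurable_realfun.
From mathcomp Require Import ring lra zify.
Import Order.TTheory GRing.Theory Num.Theory.
Import numFieldNormedType.Exports.
Local Open Scope classical_set_scope.
Local Open Scope ring_scope.

(* Suppose the set S is mu-null, and let phi : N -> [0,1] be positive only on B,
   with Psi-averages bounded below by a positive constant and with
   phi(n) f(n + m) averaging to 0 along Psi for every m. Writing phi^ for the
   continuous extension of phi to beta N and F_N(p) for the Psi_N-average of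
   h . R^p f, each phi^ F_N is continuous and has mu-integral 0. Off S, either
   phi^ = 0 or F_N is eventually smaller than a negative constant, so Fatou's
   lemma forces phi^ = 0 almost everywhere, contradicting int phi^ dmu > 0.

   The function phi comes from Bogolyubov's argument, which replaces the
   Peter-Weyl theorem for K. Let a(n0) be in U. By compactness K is covered by
   finitely many sets V with a(n0) + V - V + V - V inside U, so one of them
   contains a(n) for at least delta M of the n < M; let A be the set of these n
   and L = 4 M. The fourfold autocorrelation of A in Z/L, evaluated at n - n0,
   is positive only if a(n) is in U, and by Parseval it is uniformly close to a
   trigonometric polynomial with boundedly many terms, nonnegative coefficients
   and constant term at least (delta/4)^4. Take phi to be the limit as M tends
   to a nonprincipal ultrafilter. *)

Set Implicit Arguments.
Unset Strict Implicit.
Unset Printing Implicit Defensive.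

(** * Fourier analysis on Z/L *)

Lemma norm_cos_le1 (R : realType) (x : R) : `|cos x| <= 1.
Proof. by rewrite ler_norml cos_geN1 cos_le1. Qed.

Lemma norm_sin_le1 (R : realType) (x : R) : `|sin x| <= 1.
Proof. by rewrite ler_norml sin_geN1 sin_le1. Qed.

Lemma cos_2pin (R : realType) (n : nat) : cos (2 * pi * n%:R) = 1 :> R.
Proof.
elim: n => [|n IH]; first by rewrite mulr0 cos0.
have -> : 2 * pi * n.+1%:R = 2 * pi * n%:R + pi *+ 2 :> R.
  by rewrite -[n.+1]addn1 natrD mulrDr mulr1 mulr_natl.
by rewrite cosD cos2pi sin2pi IH mulr0 subr0 mulr1.
Qed.

Lemma sin_2pin (R : realType) (n : nat) : sin (2 * pi * n%:R) = 0 :> R.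
Proof.
by apply/eqP; rewrite -norm_cos_eq1 cos_2pin normr1.
Qed.

(** Moving the index by one does not change a sum over a full period, so the vector of cosine and
    sine sums is fixed by the rotation by [x], which fixes only zero when [cos x != 1]. *)
Lemma sum_cos_periodic (R : realType) (L : nat) (x : R) :
  cos (x * L%:R) = 1 -> sin (x * L%:R) = 0 -> cos x != 1 ->
  \sum_(k < L) cos (x * k%:R) = 0.
Proof.
move=> cL sL cx1.
set S := LHS; pose T := \sum_(k < L) sin (x * k%:R).
have tele (g : nat -> R) : g L = g 0 ->
    \sum_(k < L) g k = \sum_(k < L) g k.+1.
  move=> gL; apply: (@addIr _ (g L)).
  rewrite -(big_ord_recr L (fun k : 'I_L.+1 => g k)) big_ord_recl gL addrC.
  by congr (_ + _); apply: eq_bigr.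
have hS : S = S * cos x - T * sin x.
  rewrite {1}/S (tele (fun k => cos (x * k%:R))); last by rewrite mulr0 cos0.
  rewrite !mulr_suml -sumrB; apply: eq_bigr => i _.
  by rewrite -[i.+1]addn1 natrD mulrDr mulr1 cosD.
have hT : T = T * cos x + S * sin x.
  rewrite {1}/T (tele (fun k => sin (x * k%:R))); last by rewrite mulr0 sin0.
  rewrite !mulr_suml -big_split; apply: eq_bigr => i _.
  by rewrite -[i.+1]addn1 natrD mulrDr mulr1 sinD.
have h : (2 * (1 - cos x)) * S = 0.
  have := cos2Dsin2 x; nra.
apply/eqP; move/eqP: h; rewrite mulf_eq0 mulf_eq0 subr_eq0.
by rewrite [1 == _]eq_sym (negbTE cx1) pnatr_eq0 /=.
Qed.

(* The character [k |-> exp (2 i pi t k / L)] of Z/L, real part only: sums over a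
   symmetric family of [t] make the imaginary parts cancel. *)
Definition osc (R : realType) (L : nat) (t : R) (k : nat) : R :=
  cos (2 * pi * t / L%:R * k%:R).

Lemma oscM (R : realType) (L : nat) (s t : R) (k : nat) :
  osc L s k * osc L t k = (osc L (s + t) k + osc L (s - t) k) / 2.
Proof.
rewrite /osc (_ : _ * (s + t) / _ * _ =
  2 * pi * s / L%:R * k%:R + 2 * pi * t / L%:R * k%:R); last by lra.
rewrite (_ : _ * (s - t) / _ * _ =
  2 * pi * s / L%:R * k%:R - 2 * pi * t / L%:R * k%:R); last by lra.
by rewrite cosD cosB; lra.
Qed.

Lemma norm_osc (R : realType) (L : nat) (t : R) (k : nat) : `|osc L t k| <= 1.
Proof. exact: norm_cos_le1. Qed.

Lemma osc0 (R : realType) (L k : nat) : osc L (0 : R) k = 1.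
Proof. by rewrite /osc mulr0 !mul0r cos0. Qed.

Lemma sum_osc (R : realType) (L a b : nat) : (0 < L)%N ->
  cos (2 * pi * (a%:R - b%:R) / L%:R) != 1 :> R ->
  \sum_(k < L) osc L (a%:R - b%:R : R) k = 0.
Proof.
move=> L0; apply: sum_cos_periodic.
  rewrite mulfVK ?pnatr_eq0 -?lt0n // mulrBr cosB !cos_2pin !sin_2pin; lra.
rewrite mulfVK ?pnatr_eq0 -?lt0n // mulrBr sinB !cos_2pin !sin_2pin; lra.
Qed.

(** Either the character is trivial and every term is 1, or the sum vanishes. This is what makes
    [corr] nonnegative. *)
Lemma sum_osc_ge0 (R : realType) (L a b : nat) : (0 < L)%N ->
  0 <= \sum_(k < L) osc L (a%:R - b%:R : R) k.
Proof.
move=> L0; have [c1|/sum_osc -> //] :=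
  eqVneq (cos (2 * pi * (a%:R - b%:R) / L%:R) : R) 1.
apply: sumr_ge0 => k _; rewrite /osc.
suff -> : cos (2 * pi * (a%:R - b%:R) / L%:R * k%:R) = 1 :> R by [].
have s0 : sin (2 * pi * (a%:R - b%:R) / L%:R) = 0 :> R.
  by apply/eqP; rewrite -norm_cos_eq1 c1 normr1.
elim: (k : nat) => [|n IH]; first by rewrite mulr0 cos0.
by rewrite -[n.+1]addn1 natrD mulrDr mulr1 cosD IH c1 s0 mulr0 subr0 mulr1.
Qed.

Lemma cos_lt1 (R : realType) (x : R) : 0 < x < 2 * pi -> cos x < 1.
Proof.
move=> /andP[x0 x1].
have /sin_gt0_pi s : 0 < x / 2 < pi by apply/andP; split; lra.
rewrite (_ : x = (x / 2) *+ 2); last by rewrite mulr2n; lra.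
by rewrite cos_mulr2n mulr2n; have := cos2Dsin2 (x/2); nra.
Qed.

(** The bounds make [a] and [b] distinct modulo [L]: for [b < a] the angle lies strictly between 0
    and [2 * pi]. *)
Lemma sum_osc_eq0 (R : realType) (L a b : nat) :
  (a < b + L)%N -> (b < a + L)%N -> a != b ->
  \sum_(k < L) osc L (a%:R - b%:R : R) k = 0.
Proof.
move=> aL bL ab.
have L0 : (0 < L)%N by lia.
apply: sum_osc => //; apply/negP => /eqP c1.
wlog lt : a b aL bL ab c1 / (b < a)%N => [H|].
  case: (ltnP b a) => lt; first exact: (H a b).
  apply: (H b a) => //; rewrite 1?eq_sym //; last by lia.
  by rewrite -opprB mulrN mulNr cosN.
suff : cos (2 * pi * (a%:R - b%:R) / L%:R) < 1 :> R by rewrite c1 ltxx.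
have p := @pi_gt0 R.
apply: cos_lt1; rewrite -natrB ?(ltnW lt) //; apply/andP; split.
  by rewrite !mulr_gt0 ?invr_gt0 ?ltr0n //; lia.
rewrite ltr_pdivrMr ?ltr0n // ltr_pM2l ?mulr_gt0 // ltr_nat; lia.
Qed.

Section Spectrum.
Variables (R : realType) (L n0 : nat) (A : seq nat).

(* The squared modulus of the Fourier coefficient of [A] at [k]. *)
Definition spec (k : nat) : R :=
  \sum_(x <- A) \sum_(y <- A) osc L (x%:R - y%:R) k.

Lemma spec_ge0 k : 0 <= spec k.
Proof.
rewrite /spec.
suff -> : \sum_(x <- A) \sum_(y <- A) osc L (x%:R - y%:R) k =
  (\sum_(x <- A) cos (2 * pi * x%:R / L%:R * k%:R)) ^+ 2 +
  (\sum_(x <- A) sin (2 * pi * x%:R / L%:R * k%:R)) ^+ 2 :> R.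
  by rewrite addr_ge0 ?sqr_ge0.
rewrite !expr2 !big_distrlr -big_split; apply: eq_bigr => x _ /=.
rewrite -big_split; apply: eq_bigr => y _ /=.
by rewrite -cosB /osc; congr cos; lra.
Qed.

Lemma spec_le k : spec k <= (size A)%:R ^+ 2.
Proof.
apply: (@le_trans _ _ (\sum_(x <- A) \sum_(y <- A) 1)).
  apply: ler_sum => x _; apply: ler_sum => y _.
  by rewrite (le_trans (ler_norm _)) ?norm_osc.
by rewrite !big_const_seq !count_predT !iter_addr_0 -mulrnA natrM -expr2.
Qed.

Lemma spec0 : spec 0 = (size A)%:R ^+ 2.
Proof.
rewrite /spec (eq_bigr (fun=> \sum_(y <- A) 1)).
  by rewrite !big_const_seq !count_predT !iter_addr_0 -mulrnA natrM -expr2.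
by move=> x _; apply: eq_bigr => y _; rewrite /osc mulr0 cos0.
Qed.

(** By orthogonality only the diagonal pairs [x = y] survive, the elements of [A] being distinct
    modulo [L]. *)
Lemma parseval : uniq A -> {in A, forall x, (x < L)%N} ->
  \sum_(k < L) spec k = L%:R * (size A)%:R.
Proof.
move=> uA AL; rewrite exchange_big /= big_seq.
rewrite (eq_bigr (fun=> L%:R)).
  by rewrite -big_seq big_const_seq count_predT iter_addr_0 mulr_natr.
move=> x xA; rewrite exchange_big /= (bigD1_seq x) //=.
rewrite [X in _ + X]big1_seq ?addr0.
  under eq_bigr do rewrite subrr osc0.
  by rewrite sumr_const card_ord.
move=> y /andP[yx yA]; apply: sum_osc_eq0; rewrite 1?eq_sym //.
  by have := AL _ xA; lia.
by have := AL _ yA; lia.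
Qed.

(* By Fourier inversion this is [L ^- 3] times the number of [(x, y, z, w)] in
   [A ^ 4] with [x - y + z - w = n - n0] modulo [L]. *)
Definition corr (n : nat) : R :=
  (L%:R ^+ 4)^-1 * \sum_(k < L) spec k ^+ 2 * osc L (n%:R - n0%:R) k.

Let D (x y z w n : nat) : R := \sum_(k < L)
   osc L (x%:R - y%:R) k * osc L (z%:R - w%:R) k * osc L (n%:R - n0%:R) k.

(** Two product-to-sum steps; the signs are regrouped so that each frequency is a difference of
    natural numbers, as orthogonality requires. *)
Let DE x y z w n : D x y z w n = 
  4^-1 * (\sum_(k < L) osc L ((x + z + n)%N%:R - (y + w + n0)%N%:R) k +
          \sum_(k < L) osc L ((x + z + n0)%N%:R - (y + w + n)%N%:R) k +
          \sum_(k < L) osc L ((x + w + n)%N%:R - (y + z + n0)%N%:R) k +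
          \sum_(k < L) osc L ((x + w + n0)%N%:R - (y + z + n)%N%:R) k).
Proof.
rewrite -!big_split /= mulr_sumr; apply: eq_bigr => k _.
rewrite oscM mulrAC mulrDl !oscM !natrD.
rewrite (_ : x%:R - y%:R + (z%:R - w%:R) + (n%:R - n0%:R) =
  x%:R + z%:R + n%:R - (y%:R + w%:R + n0%:R)); last by lra.
rewrite (_ : x%:R - y%:R + (z%:R - w%:R) - (n%:R - n0%:R) =
  x%:R + z%:R + n0%:R - (y%:R + w%:R + n%:R)); last by lra.
rewrite (_ : x%:R - y%:R - (z%:R - w%:R) + (n%:R - n0%:R) =
  x%:R + w%:R + n%:R - (y%:R + z%:R + n0%:R)); last by lra.
rewrite (_ : x%:R - y%:R - (z%:R - w%:R) - (n%:R - n0%:R) =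
  x%:R + w%:R + n0%:R - (y%:R + z%:R + n%:R)); last by lra.
lra.
Qed.

Let corrE n : corr n = (L%:R ^+ 4)^-1 * 
  \sum_(x <- A) \sum_(y <- A) \sum_(z <- A) \sum_(w <- A) D x y z w n.
Proof.
congr (_ * _); rewrite /D.
under [RHS]eq_bigr => x _.
  under eq_bigr => y _.
    under eq_bigr => z _ do rewrite exchange_big.
    rewrite exchange_big; over.
  rewrite exchange_big; over.
rewrite exchange_big /=; apply: eq_bigr => k _.
rewrite expr2 /spec big_distrl /= big_distrl; apply: eq_bigr => x _ /=.
rewrite big_distrl /= big_distrl; apply: eq_bigr => y _ /=.
rewrite big_distrr /= big_distrl; apply: eq_bigr => z _ /=.
by rewrite big_distrr /= big_distrl.
Qed.

Lemma corr_ge0 n : (0 < L)%N -> 0 <= corr n.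
Proof.
move=> L0; rewrite corrE mulr_ge0 ?invr_ge0 ?exprn_ge0 ?ler0n //.
do 4!(apply: sumr_ge0 => ? _).
by rewrite DE mulr_ge0 ?invr_ge0 ?ler0n // !addr_ge0 ?sum_osc_ge0.
Qed.

(** Each frequency is a difference of two sums of three numbers below [M], so with [L = 4 M] nothing
    wraps around and a congruence modulo [L] is an equality. Up to sign, the four frequencies differ
    by swapping [x] with [y] or [z] with [w]. *)
Lemma corr_gt0 M n : L = (4 * M)%N -> (n < M)%N -> (n0 < M)%N ->
  {in A, forall x, (x < M)%N} -> 0 < corr n ->
  exists x y z w, [/\ x \in A, y \in A, z \in A & w \in A] /\
    (n + y + w = n0 + x + z)%N.
Proof.
move=> LM nM n0M AM; apply: contraPP => nex; rewrite corrE.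
suff -> : \sum_(x <- A) \sum_(y <- A) \sum_(z <- A) \sum_(w <- A) D x y z w n = 0.
  by rewrite mulr0 ltxx.
apply: big1_seq => x /= xA; apply: big1_seq => y /= yA.
apply: big1_seq => z /= zA; apply: big1_seq => w /= wA.
have xM := AM _ xA; have yM := AM _ yA; have zM := AM _ zA; have wM := AM _ wA.
rewrite DE !sum_osc_eq0 ?addr0 ?mulr0 //; try lia.
- by apply/negP => /eqP e; apply: nex; exists x, y, w, z; split => //; lia.
- by apply/negP => /eqP e; apply: nex; exists y, x, z, w; split => //; lia.
- by apply/negP => /eqP e; apply: nex; exists x, y, z, w; split => //; lia.
- by apply/negP => /eqP e; apply: nex; exists y, x, w, z; split => //; lia.
Qed.

End Spectrum.

(** Bounding one factor of [spec ^+ 2] by [L ^+ 2] leaves a sum that Parseval bounds by [L ^+ 2]. *)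
Lemma corr_le1 (R : realType) (L n0 : nat) (A : seq nat) (n : nat) :
  (0 < L)%N -> uniq A -> {in A, forall x, (x < L)%N} -> corr R L n0 A n <= 1.
Proof.
move=> L0 uA AL; have AL' : (size A <= L)%N.
  by rewrite -[L](size_iota 0); apply: uniq_leq_size => // x /AL; rewrite mem_iota.
have LR : 0 < L%:R :> R by rewrite ltr0n.
have AR : (size A)%:R <= L%:R :> R by rewrite ler_nat.
rewrite /corr mulrC ler_pdivrMr ?exprn_gt0 // mul1r.
apply: (@le_trans _ _ (\sum_(k < L) L%:R ^+ 2 * spec R L A k)).
  apply: ler_sum => k _.
  apply: (@le_trans _ _ (spec R L A k ^+ 2)).
    by rewrite ler_piMr ?sqr_ge0 // cos_le1.
  rewrite expr2 ler_wpM2r ?spec_ge0 // (le_trans (spec_le _ _ _ _)) //.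
  by rewrite lerXn2r ?nnegrE ?ler0n.
rewrite -mulr_sumr parseval // (exprD _ 2 2) [X in _ <= _ * X]expr2.
by rewrite ler_wpM2l ?exprn_ge0 ?ler0n // ler_wpM2l ?ler0n.
Qed.

(* Only boundedly many frequencies of a set can be large, because of Parseval. *)
Lemma corr_approx (R : realType) (L n0 : nat) (A : seq nat) (tau : R) (k : nat) :
  (0 < L)%N -> uniq A -> {in A, forall x, (x < L)%N} ->
  0 < tau -> tau^-1 <= k%:R ->
  exists c th : nat -> R, [/\ forall i, 0 <= c i <= 1,
    forall i, 0 <= th i <= 1 &
    forall n, `|corr R L n0 A n - (((size A)%:R / L%:R) ^+ 4 +
      \sum_(i < k) c i * cos (2 * pi * (n%:R - n0%:R) * th i))| <= tau].
Proof.
move=> L0 uA AL tau0 tauk; have AL' : (size A <= L)%N.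
  by rewrite -[L](size_iota 0); apply: uniq_leq_size => // x /AL; rewrite mem_iota.
have LR : 0 < L%:R :> R by rewrite ltr0n.
have AR : (size A)%:R <= L%:R :> R by rewrite ler_nat.
pose P := spec R L A.
have P0 j : 0 <= P j by apply: spec_ge0.
have PL j : P j <= L%:R ^+ 2.
  by rewrite (le_trans (spec_le _ _ _ _)) // lerXn2r ?nnegrE ?ler0n.
(* Frequency 0 is left out because it supplies the constant term of the approximation. *)
have sP : \sum_(1 <= j < L) P j <= L%:R ^+ 2.
  apply: (@le_trans _ _ (\sum_(0 <= j < L) P j)).
    by rewrite [leRHS]big_ltn // lerDr.
  by rewrite big_mkord parseval // expr2 ler_wpM2l // ler0n.
pose Q j := tau * L%:R ^+ 2 <= P j.
pose s := [seq j <- index_iota 1 L | Q j].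
have sk : (size s <= k)%N.
  rewrite -(ler_nat R) (le_trans _ tauk) // -[tau^-1]mul1r ler_pdivlMr //.
  rewrite -(ler_pM2r (exprn_gt0 2 LR)) mul1r (le_trans _ sP) //.
  rewrite (bigID Q) /= -[X in X + _]big_filter -/s.
  apply: (@le_trans _ _ (\sum_(j <- s) P j)); last by rewrite lerDl sumr_ge0.
  apply: (@le_trans _ _ (\sum_(j <- s) tau * L%:R ^+ 2)).
    by rewrite big_const_seq count_predT iter_addr_0 -[leRHS]mulr_natl mulrA.
  rewrite big_seq [leRHS]big_seq; apply: ler_sum => j.
  by rewrite mem_filter => /andP[].
(* Zero coefficients pad [s] to length [k], which depends on neither [L] nor [A]; this uniformity
   allows a later passage to the limit. *)
exists (fun i => if (i < size s)%N then P (nth 0%N s i) ^+ 2 / L%:R ^+ 4 else 0).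
exists (fun i => (nth 0%N s i)%:R / L%:R); split.
- move=> i; case: ifP => _; last by rewrite lexx ler01.
  rewrite divr_ge0 ?exprn_ge0 ?P0 ?ler0n //= ler_pdivrMr ?exprn_gt0 // mul1r.
  by rewrite (exprM _ 2 2) lerXn2r ?nnegrE ?P0 ?exprn_ge0 ?ler0n.
- move=> i; rewrite divr_ge0 ?ler0n //= ler_pdivrMr // mul1r ler_nat.
  have [si|si] := ltnP i (size s); last by rewrite nth_default.
  have := mem_nth 0%N si; rewrite mem_filter mem_index_iota.
  by case/and3P => _ _ /ltnW.
move=> n.
have -> : \sum_(i < k)
    (if (i < size s)%N then P (nth 0%N s i) ^+ 2 / L%:R ^+ 4 else 0) *
    cos (2 * pi * (n%:R - n0%:R) * ((nth 0%N s i)%:R / L%:R)) =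
    (L%:R ^+ 4)^-1 * \sum_(1 <= j < L | Q j) P j ^+ 2 * osc L (n%:R - n0%:R) j.
  rewrite -(big_mkord xpredT (fun i => (if (i < size s)%N then
    P (nth 0%N s i) ^+ 2 / L%:R ^+ 4 else 0) *
    cos (2 * pi * (n%:R - n0%:R) * ((nth 0%N s i)%:R / L%:R)))).
  rewrite (big_cat_nat _ sk) //= [X in _ + X]big_nat_cond.
  rewrite [X in _ + X]big1 ?addr0; last first.
    by move=> i /andP[/andP[+ _] _]; rewrite leqNgt => /negbTE ->; rewrite mul0r.
  rewrite -[in RHS]big_filter -/s [in RHS](big_nth 0%N) [RHS]mulr_sumr.
  rewrite big_nat_cond [RHS]big_nat_cond; apply: eq_bigr => i /andP[/andP[_ ->] _].
  rewrite [X in X * cos _]mulrC -[LHS]mulrA; congr (_ * (_ * _)).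
  by rewrite /osc; congr cos; ring.
rewrite /corr -(big_mkord xpredT (fun j => P j ^+ 2 * osc L (n%:R - n0%:R) j)).
rewrite big_ltn // mulrDr (_ : osc _ _ 0 = 1) ?mulr1; last first.
  by rewrite /osc mulr0 cos0.
rewrite {1}/P spec0 -exprM expr_div_n [X in _ - (X + _)]mulrC opprD addrACA.
rewrite subrr add0r.
rewrite (bigID Q) /= mulrDr addrAC subrr add0r normrM ger0_norm; last first.
  by rewrite invr_ge0 exprn_ge0.
rewrite mulrC ler_pdivrMr ?exprn_gt0 //.
apply: (le_trans (ler_norm_sum _ _ _)).
(* On a small frequency one factor of [P j ^+ 2] is below [tau * L ^+ 2]; the other is summed by
   Parseval. *)
apply: (@le_trans _ _ (\sum_(1 <= j < L | ~~ Q j) tau * L%:R ^+ 2 * P j)).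
  apply: ler_sum => j; rewrite -ltNge => /ltW Pj.
  rewrite normrM ger0_norm ?sqr_ge0 //.
  apply: (@le_trans _ _ (P j ^+ 2)); first by rewrite ler_piMr ?sqr_ge0 ?norm_osc.
  by rewrite expr2 ler_wpM2r.
rewrite -mulr_sumr (_ : tau * L%:R ^+ 4 = tau * L%:R ^+ 2 * L%:R ^+ 2); last by ring.
rewrite ler_wpM2l ?mulr_ge0 ?exprn_ge0 ?(ltW tau0) //.
by rewrite (le_trans _ sP) // [leRHS](bigID Q) /= lerDr sumr_ge0.
Qed.

(** * Averages along a Folner sequence *)

Section Averages.
Variables (R : realType) (Psi : nat -> {fset nat}).
Implicit Types u v : nat -> R.

Lemma favgD u v N :
  favg Psi N (fun n => u n + v n) = favg Psi N u + favg Psi N v.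
Proof. by rewrite /favg big_split mulrDr. Qed.

Lemma favgZ (c : R) u N : favg Psi N (fun n => c * u n) = c * favg Psi N u.
Proof. by rewrite /favg -mulr_sumr mulrCA. Qed.

Lemma favgB u v N :
  favg Psi N (fun n => u n - v n) = favg Psi N u - favg Psi N v.
Proof. by rewrite /favg sumrB mulrBr. Qed.

Lemma favg_sum (k : nat) (u : 'I_k -> nat -> R) N :
  favg Psi N (fun n => \sum_(i < k) u i n) = \sum_(i < k) favg Psi N (u i).
Proof. by rewrite /favg exchange_big mulr_sumr. Qed.

Hypothesis Psi0 : forall N, Psi N != fset0.

Lemma favg_cst (c : R) N : favg Psi N (fun=> c) = c.
Proof.
rewrite /favg big_const_seq count_predT iter_addr_0 -[c *+ _]mulr_natl mulrA.
rewrite mulVf ?mul1r //.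
by rewrite pnatr_eq0 cardfs_eq0.
Qed.

Lemma ler_favg u v N : (forall n, u n <= v n) -> favg Psi N u <= favg Psi N v.
Proof. by move=> uv; rewrite /favg ler_wpM2l ?invr_ge0 // ler_sum. Qed.

Lemma norm_favg u N (M : R) : (forall n, `|u n| <= M) -> `|favg Psi N u| <= M.
Proof.
move=> uM; rewrite ler_norml -[- M](favg_cst _ N) -[in X in _ && X](favg_cst M N).
by rewrite !ler_favg // => n; have := uM n; rewrite ler_norml => /andP[].
Qed.

Hypothesis Psi_folner : folner R Psi.

Lemma sum_fshift (A : {fset nat}) m u :
  \sum_(n <- fshift A m) u n = \sum_(n <- A) u (n + m)%N.
Proof.
rewrite big_imfset //= => x y _ _ /eqP; rewrite eqn_add2r; exact/eqP.
Qed.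

(** The two sums agree on the overlap of [Psi N] with its translate, so only the symmetric
    difference contributes. *)
Lemma favg_shift (m : nat) u : bounded_seq u ->
  (fun N => favg Psi N (fun n => u (n + m)%N) - favg Psi N u) @ \oo --> (0 : R).
Proof.
move=> [M uM].
have M0 : 0 <= M by rewrite (le_trans _ (uM 0%N)).
have sumM (C : {fset nat}) : `|\sum_(n <- C) u n| <= M * #|` C|%:R.
  apply: (le_trans (ler_norm_sum _ _ _)).
  apply: (@le_trans _ _ (\sum_(n <- C) M)); first exact: ler_sum.
  by rewrite big_const_seq count_predT iter_addr_0 mulr_natr.
have c0 : (M * (#|` ((fshift (Psi N) m `\` Psi N) `|`
    (Psi N `\` fshift (Psi N) m))%fset|%:R / (#|` Psi N|%:R))) @[N --> \oo] --> (0 : R).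
  by rewrite -(mulr0 M); apply: cvgMl_tmp; apply: Psi_folner.2.
apply/norm_cvg0P; apply: squeeze_cvgr (cvg_cst 0) c0; near=> N.
rewrite normr_ge0 /= /favg -mulrBr normrM ger0_norm ?invr_ge0 ?ler0n // mulrC mulrA.
rewrite ler_wpM2r ?invr_ge0 ?ler0n // -sum_fshift.
set A := fshift _ _; set C := Psi N.
have setDE (X Y : {fset nat}) : [fset x in X | x \notin Y]%fset = (X `\` Y)%fset.
  by apply/fsetP => x; rewrite !inE andbC.
have setIE (X Y : {fset nat}) : [fset x in X | x \in Y]%fset = (X `&` Y)%fset.
  by apply/fsetP => x; rewrite !inE.
rewrite (big_fsetID _ (mem C) A) (big_fsetID _ (mem A) C) /= !setDE !setIE fsetIC.
rewrite opprD addrACA subrr add0r.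
rewrite (le_trans (ler_normB _ _)) // (le_trans (lerD (sumM _) (sumM _))) //.
rewrite -mulrDr -natrD -cardfsUI (_ : (_ `&` _)%fset = fset0) ?cardfs0 ?addn0 //.
by apply/fsetP => x; rewrite !inE; case: (x \in A); case: (x \in C).
Unshelve. all: by end_near.
Qed.

End Averages.

(** * Averages of characters and of almost periodic functions *)

Section Characters.
Variables (R : realType) (Psi : nat -> {fset nat}).
Hypothesis Psi_folner : folner R Psi.
Let Psi0 : forall N, Psi N != fset0 := Psi_folner.1.

(* The averages of [cos] and [sin] are almost invariant under the rotation by
   [x], which has no nonzero fixed vector. *)
Lemma cvg_favg_cos (n0 : nat) (x : R) : cos x != 1 ->
  favg Psi N (fun n => cos (x * (n%:R - n0%:R))) @[N --> \oo] --> (0 : R).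
Proof.
move=> x1.
pose c n := cos (x * (n%:R - n0%:R)); pose s n := sin (x * (n%:R - n0%:R)).
have bc : bounded_seq c by exists 1 => n; exact: norm_cos_le1.
have bs : bounded_seq s by exists 1 => n; exact: norm_sin_le1.
have hc := favg_shift Psi_folner 1 bc; have hs := favg_shift Psi_folner 1 bs.
have next n : x * ((n + 1)%:R - n0%:R) = x * (n%:R - n0%:R) + x.
  by rewrite natrD; ring.
pose d := 2 * (1 - cos x).
have d0 : d != 0.
  by rewrite mulf_neq0 // ?pnatr_eq0 // subr_eq0 eq_sym.
(* Here [d] is the determinant of the identity minus the rotation by [x]; solving the linear system
   expresses the average of [c] through the two shift defects. *)
have -> : (fun N => favg Psi N c) = fun N => d^-1 * (
    (cos x - 1) * (favg Psi N (fun n => c (n + 1)%N) - favg Psi N c) +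
    sin x * (favg Psi N (fun n => s (n + 1)%N) - favg Psi N s)).
  apply/funext => N.
  have -> : (fun n => c (n + 1)%N) = fun n => cos x * c n - sin x * s n.
    by apply/funext => n; rewrite /c /s next cosD; ring.
  have -> : (fun n => s (n + 1)%N) = fun n => sin x * c n + cos x * s n.
    by apply/funext => n; rewrite /c /s next sinD; ring.
  rewrite favgB favgD !favgZ.
  have e := cos2Dsin2 x.
  apply: (mulfI d0); rewrite mulVKf //.
  transitivity ((cos x ^+ 2 + sin x ^+ 2 - 2 * cos x + 1) * favg Psi N c).
    by rewrite e /d; ring.
  by ring.
rewrite [X in _ --> X](_ : 0 = d^-1 * ((cos x - 1) * 0 + sin x * 0)).
  by apply: cvgMl_tmp; apply: cvgD; apply: cvgMl_tmp; [exact: hc|exact: hs].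
by rewrite !mulr0 addr0 mulr0.
Qed.

Lemma near_favg_cos (n0 : nat) (x e : R) : 0 < e ->
  \forall N \near \oo, - e <= favg Psi N (fun n => cos (x * (n%:R - n0%:R))).
Proof.
move=> e0; have [c1|c1] := eqVneq (cos x) 1.
  have s0 : sin x = 0 by apply/eqP; rewrite -norm_cos_eq1 c1 normr1.
  have cs n : cos (x * n%:R) = 1 /\ sin (x * n%:R) = 0.
    elim: n => [|n [IHc IHs]]; first by rewrite mulr0 cos0 sin0.
    rewrite -[n.+1]addn1 natrD mulrDr mulr1 cosD sinD c1 s0 IHc IHs.
    by split; ring.
  apply: nearW => N; rewrite (_ : (fun _ => _) = fun=> 1); last first.
    apply/funext => n; rewrite mulrBr cosB.
    by rewrite !(cs _).1 !(cs _).2; ring.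
  by rewrite favg_cst // (le_trans _ ler01) // oppr_le0 ltW.
have := cvg_favg_cos n0 c1 => /cvgr0Pnorm_le /(_ e e0).
by apply: filterS => N; rewrite ler_norml => /andP[].
Qed.

(* Some of the frequencies [th i] may be 0 or 1, so [c0] is only a lower bound
   for the mean of [phi]. *)
Definition bohr_positive (n0 : nat) (c0 : R) (phi : nat -> R) : Prop :=
  forall tau : R, 0 < tau -> exists (k : nat) (c th : nat -> R),
    [/\ forall i, 0 <= c i <= 1, forall i, 0 <= th i <= 1 &
    forall n, `|phi n - (c0 + \sum_(i < k)
      c i * cos (2 * pi * (n%:R - n0%:R) * th i))| <= tau].

(** Since the coefficients are nonnegative, lower bounds on the averages of the cosines suffice.
    Half the gap [c0 - d] pays for the approximation error, half for the cosines. *)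
Lemma near_favg_bohr (n0 : nat) (c0 : R) (phi : nat -> R) (d : R) :
  bohr_positive n0 c0 phi -> d < c0 ->
  \forall N \near \oo, d <= favg Psi N phi.
Proof.
move=> hphi dc0; pose tau := (c0 - d) / 2.
have tau0 : 0 < tau by rewrite /tau; lra.
have [k [c [th [hc hth happ]]]] := hphi _ tau0.
(* The successor keeps the divisor positive when [k = 0]. *)
pose e := tau / k.+1%:R.
have e0 : 0 < e by rewrite divr_gt0 // ltr0n.
have hN : \forall N \near \oo, forall i : 'I_k,
    - e <= favg Psi N (fun n => cos (2 * pi * th i * (n%:R - n0%:R))).
  by apply: filter_forall => i; exact: near_favg_cos.
apply: filterS hN => N hN.
apply: (@le_trans _ _ (favg Psi N (fun n => (c0 - tau) +
    \sum_(i < k) c i * cos (2 * pi * th i * (n%:R - n0%:R))))).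
  rewrite favgD favg_cst // favg_sum.
  suff : - tau <= \sum_(i < k) favg Psi N
     (fun n => c i * cos (2 * pi * th i * (n%:R - n0%:R))) by rewrite /tau; lra.
  apply: (@le_trans _ _ (\sum_(i < k) - e)).
    rewrite sumr_const card_ord -mulr_natr mulNr lerN2 /e mulrAC ler_pdivrMr ?ltr0n //.
    by rewrite ler_wpM2l ?(ltW tau0) // ler_nat.
  apply: ler_sum => i _; rewrite favgZ.
  have /andP[ci0 ci1] := hc i; have := hN i; nra.
apply: ler_favg => // n; have := happ n; rewrite ler_norml => /andP[+ _].
have -> : \sum_(i < k) c i * cos (2 * pi * (n%:R - n0%:R) * th i) =
    \sum_(i < k) c i * cos (2 * pi * th i * (n%:R - n0%:R)).
  by apply: eq_bigr => i _; rewrite mulrAC.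
by lra.
Qed.

Variable f : nat -> R.
Hypotheses (f_bounded : bounded_seq f) (f_perp : bes_perp Psi f).

(** The translation by [m] is absorbed into the phase [b], at the cost of a shift defect that tends
    to 0. *)
Lemma cvg_favg_perp_cos (n0 m : nat) (x : R) : 0 <= x <= 1 ->
  favg Psi N (fun n => f (n + m)%N * cos (2 * pi * (n%:R - n0%:R) * x))
    @[N --> \oo] --> (0 : R).
Proof.
(* On integers frequency 1 is the same as frequency 0; it is allowed because frequencies below 1 may
   have limit 1. *)
move=> /andP[]; wlog x1 : x / x < 1 => [H x0 xle1|x0 _].
  move: xle1; rewrite le_eqVlt => /predU1P[->|x1]; last exact: (H x x1 x0 (ltW x1)).
  rewrite (_ : (fun N => _) = fun N => favg Psi N
      (fun n => f (n + m)%N * cos (2 * pi * (n%:R - n0%:R) * 0))).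
    by apply: H; rewrite ?ler01 ?ltr01.
  apply/funext => N; congr favg; apply/funext => n; congr (_ * _).
  by rewrite mulr1 mulr0 mulrBr cosB !cos_2pin !sin_2pin cos0; ring.
have [hc hs] := f_perp.2 x (introT andP (conj x0 x1)).
pose b := 2 * pi * (m + n0)%:R * x.
pose u n := f n * cos (2 * pi * n%:R * x - b).
have bu : bounded_seq u.
  case: f_bounded => M hM; exists M => n; rewrite normrM.
  by rewrite (le_trans _ (hM n)) // ler_piMr // norm_cos_le1.
rewrite (_ : (fun N => _) = fun N =>
  (favg Psi N (fun n => u (n + m)%N) - favg Psi N u) +
  (cos b * favg Psi N (fun n => f n * cos (2 * pi * n%:R * x)) +
   sin b * favg Psi N (fun n => f n * sin (2 * pi * n%:R * x)))); last first.
  apply/funext => N; rewrite -!favgZ -favgD.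
  rewrite (_ : (fun n => _ + _) = u) ?subrK; last first.
    by apply/funext => n; rewrite /u cosB; ring.
  congr favg; apply/funext => n; rewrite /u /b; congr (_ * cos _).
  by rewrite !natrD; ring.
rewrite [X in _ --> X](_ : 0 = 0 + (cos b * 0 + sin b * 0)).
  apply: cvgD; first exact: favg_shift.
  by apply: cvgD; exact: cvgMl_tmp.
by rewrite !mulr0 !addr0.
Qed.

Lemma cvg_favg_perp_bohr (n0 : nat) (c0 : R) (phi : nat -> R) (m : nat) :
  bohr_positive n0 c0 phi ->
  favg Psi N (fun n => f (n + m)%N * phi n) @[N --> \oo] --> (0 : R).
Proof.
move=> hphi; apply/cvgr0Pnorm_le => e e0.
have [M hM] := f_bounded.
have M0 : 0 <= M by rewrite (le_trans _ (hM 0%N)).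
pose tau := e / 2 / (M + 1).
have tau0 : 0 < tau by rewrite !divr_gt0 //; lra.
have [k [c [th [hc hth happ]]]] := hphi _ tau0.
pose T n := c0 + \sum_(i < k) c i * cos (2 * pi * (n%:R - n0%:R) * th i).
(* The constant [c0] is treated as a cosine of frequency 0. *)
have hT : favg Psi N (fun n => f (n + m)%N * T n) @[N --> \oo] --> (0 : R).
  rewrite (_ : (fun N => _) = fun N =>
    c0 * favg Psi N (fun n => f (n + m)%N * cos (2 * pi * (n%:R - n0%:R) * 0)) +
    \sum_(i < k) c i * favg Psi N
      (fun n => f (n + m)%N * cos (2 * pi * (n%:R - n0%:R) * th i))); last first.
    apply/funext => N; rewrite -favgZ; under eq_bigr do rewrite -favgZ.
    rewrite -favg_sum -favgD; congr favg; apply/funext => n.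
    rewrite /T mulr0 cos0 mulr1 mulrDr mulr_sumr mulrC; congr (_ + _).
    by apply: eq_bigr => i _; rewrite mulrCA.
  rewrite [X in _ --> X](_ : 0 = c0 * 0 + \sum_(i < k) c i * 0); last first.
    by rewrite mulr0 add0r big1 // => i _; rewrite mulr0.
  apply: cvgD.
    by apply: cvgMl_tmp; apply: cvg_favg_perp_cos; rewrite lexx ler01.
  apply: (cvg_big add_continuous) => i _; apply: cvgMl_tmp; exact: cvg_favg_perp_cos.
have e20 : 0 < e / 2 by lra.
move/cvgr0Pnorm_le : hT => /(_ _ e20); apply: filterS => N hN.
have -> : (fun n => f (n + m)%N * phi n) = fun n =>
    f (n + m)%N * (phi n - T n) + f (n + m)%N * T n.
  by apply/funext => n; ring.
rewrite favgD (le_trans (ler_normD _ _)) // [leRHS](_ : e = e / 2 + e / 2); last by lra.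
rewrite lerD //; apply: norm_favg => // n; rewrite normrM.
apply: (@le_trans _ _ (M * tau)); first by rewrite ler_pM.
rewrite /tau mulrCA -[leRHS]mulr1 ler_wpM2l ?(ltW e20) // ler_pdivrMr; lra.
Qed.

End Characters.

(** * Ultrafilter limits *)

Lemma betaN_ultra (p : betaN) : UltraFilter (sval p).
Proof. by case: p => F [UF]. Qed.
#[local] Existing Instance betaN_ultra.

Section Ulim.
Variable R : realType.
Implicit Types (u v : nat -> R) (p : betaN).

(** By compactness of the interval the image ultrafilter has a cluster point, and an ultrafilter
    converges to its cluster points. *)
Lemma ulim_cvg p u : bounded_seq u -> u @ sval p --> ulim p u.
Proof.
move=> [M uM]; apply/cvg_ex.
have Fu : (u @ sval p) `[- M, M]%classic.
  by apply: nearW => n /=; rewrite in_itv /= -ler_norml.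
have [l [_ cl]] := segment_compact _ Fu.
exists l => V Vl; have [//|nV] := in_ultra_setVsetC (u @^-1` V) (betaN_ultra p).
by have [x [nVx Vx]] := cl (~` V) V nV Vl.
Qed.

Lemma ulimE p u (l : R) : u @ sval p --> l -> ulim p u = l.
Proof. by move=> ul; apply/cvg_lim. Qed.

Lemma ulim_closed p u (C : set R) : bounded_seq u -> closed C ->
  sval p (u @^-1` C) -> C (ulim p u).
Proof. by move=> bu Ccl pC; apply: (closed_cvg _ Ccl pC); apply: ulim_cvg. Qed.

Lemma open_clN (A : set nat) : open (clN A).
Proof. by exists [set A] => //; rewrite bigcup_set1. Qed.

(** The indices where [u] is [e]-close to its limit at [p] define a basic neighbourhood of [p], on
    which the limits stay in the same closed ball. *)
Lemma continuous_ulim u : bounded_seq u -> continuous (fun p => ulim p u).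
Proof.
move=> bu p; apply/(@cvgrPdist_le _ _ _ _ (nbhs_filter p)) => e e0.
have pA : sval p [set n | `|ulim p u - u n| <= e].
  by move/cvgrPdist_le : (@ulim_cvg p u bu) => /(_ e e0).
have nA : nbhs p (clN [set n | `|ulim p u - u n| <= e]).
  by apply: open_nbhs_nbhs; split => //; exact: open_clN.
apply: (@filterS _ _ (nbhs_filter p) _ _ _ nA) => q qA.
apply: (@ulim_closed q u [set x | `|ulim p u - x| <= e]) => //.
rewrite (_ : [set x | _] = closed_ball (ulim p u) e).
  exact: closed_ball_closed.
by rewrite closed_ballE.
Qed.

Lemma ulim_principal n u : ulim (principal_uf n) u = u n.
Proof. by apply: ulimE => V Vn k /= ->; exact: nbhs_singleton. Qed.

Lemma near_ulim p u v : (\forall n \near sval p, u n = v n) -> ulim p u = ulim p v.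
Proof.
move=> uv; congr (lim _); apply/seteqP; split => V;
  by apply: filterS2 uv => n /= ->.
Qed.

Lemma ulim_cst p (c : R) : ulim p (fun=> c) = c.
Proof. by apply: ulimE; exact: cvg_cst. Qed.

Lemma ulim_notin p u (A : set nat) :
  (forall n, u n != 0 -> A n) -> ~ clN A p -> ulim p u = 0.
Proof.
move=> uA nA; rewrite -(@ulim_cst p 0); apply: near_ulim.
have [//|cA] := in_ultra_setVsetC A (betaN_ultra p).
by apply: filterS cA => n nAn; apply/eqP/negP => /negP /uA.
Qed.

Lemma norm_ulim p u (M : R) : (forall n, `|u n| <= M) -> `|ulim p u| <= M.
Proof.
move=> uM; have : closed `[- M, M]%classic by exact: interval_closed.
move=> /(@ulim_closed p u) /= h; rewrite ler_norml.
have -> : (- M <= ulim p u <= M) = (ulim p u \in `[- M, M]) by rewrite in_itv.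
by apply: h; [exists M|apply: nearW => n /=; rewrite in_itv /= -ler_norml].
Qed.

Lemma ulimM p u v : bounded_seq u -> bounded_seq v ->
  ulim p (fun n => u n * v n) = ulim p u * ulim p v.
Proof. by move=> bu bv; apply: ulimE; apply: cvgM; exact: ulim_cvg. Qed.

End Ulim.

(** * Bogolyubov's argument *)

(* [compact_cover] is only available for pointed spaces. *)
HB.instance Definition _ (K : topologicalZmodType) :=
  Topological.copy (zpointed K) K.

Lemma finite_coloring (K : topologicalZmodType) (U : set K) (u : K) :
  compact [set: K] -> open U -> U u ->
  exists (D : {fset K}) (V : K -> set K),
    (forall t, exists2 s, s \in D & V s t) /\
    forall s x y z w, V s x -> V s y -> V s z -> V s w ->
      U (u + (x - y) + (z - w)).
Proof.
move=> Kc Uo Uu.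
have [W W0 WU] : exists2 W, nbhs (0 : K) W &
    forall d e, W d -> W e -> U (u + d + e).
  have c1 : (fun p : K * K => u + (p.1 + p.2)) @ nbhs ((0 : K), (0 : K)) --> u.
    rewrite [X in _ --> X](_ : u = u + (0 + 0)); last by rewrite !addr0.
    apply: (@continuous2_cvg _ _ _ _ _ _ _ _ (fun x y => x + y)).
    - exact: (@tvs.add_continuous K (u, 0 + 0)).
    - exact: cvg_cst.
    - exact: (@tvs.add_continuous K (0, 0)).
  have /c1 [[A B] /= [A0 B0] AB] : nbhs u U by exact: open_nbhs_nbhs.
  exists (A `&` B); first exact: filterI.
  by move=> d e [Ad _] [_ Be]; rewrite -addrA; apply: (AB (d, e)).
have hV s : exists V, [/\ open V, V s & forall x y, V x -> V y -> W (x - y)].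
  have c2 := @tvs.sub_continuous K (s, s).
  have /c2 [[A B] /= [As Bs] AB] : nbhs (s - s) W by rewrite subrr.
  exists (interior (A `&` B)); split; first exact: open_interior.
    by rewrite /interior; exact: filterI.
  by move=> x y /interior_subset [Ax _] /interior_subset [_ By]; apply: (AB (x, y)).
have /choice [V VP] := hV.
have /(_ K setT V) [] : cover_compact (T := zpointed K) setT.
- by rewrite -compact_cover; exact: Kc.
- by move=> s _; case: (VP s).
- by move=> s _; exists s => //; case: (VP s).
move=> D _ DV; exists D, V; split.
  by move=> t; have [s sD Vt] := DV t I; exists s.
move=> s x y z w Vx Vy Vz Vw; have [_ _ VW] := VP s.
by apply: WU; apply: VW.
Qed.

(** Pigeonhole: the counts of the colours in [D] add up to [M]. *)
Lemma popular_color (T : choiceType) (D : {fset T}) (col : nat -> T) (M : nat) :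
  (forall n, col n \in D) ->
  exists s, (M <= #|` D| * count (fun n => col n == s) (iota 0 M))%N.
Proof.
move=> colD; apply: contrapT => /forallNP h.
have D0 : (0 < #|` D|)%N by rewrite cardfs_gt0; apply/fset0Pn; exists (col 0%N).
have lt s : (#|` D| * count (fun n => col n == s) (iota 0 M) <= M.-1)%N.
  by have := h s; move/negP; rewrite -ltnNge; lia.
have M0 : (0 < M)%N by have := h (col 0%N); case: (M).
have : (\sum_(s <- D) #|` D| * count (fun n => col n == s) (iota 0 M) <=
        \sum_(s <- D) M.-1)%N by apply: leq_sum => s _.
rewrite -big_distrr /= big_const_seq count_predT iter_addn_0 mulnC.
under eq_bigr do rewrite -sum1_count big_mkcond /=.
rewrite exchange_big /= (eq_bigr (fun=> 1%N)); last first.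
  move=> n _; rewrite -big_mkcond /= sum1_count.
  by rewrite (eq_count (a2 := pred1 (col n))) ?count_uniq_mem ?colD.
by rewrite sum1_size size_iota leq_pmul2r //; lia.
Qed.

(** Limits along this nonprincipal [q] replace the limit in [M], since no convergence in [M] is
    known. *)
Lemma ultrafilter_oo : exists q : betaN, forall A : set nat,
  (\forall n \near \oo, A n) -> sval q A.
Proof.
have [G [UG ooG]] := ultraFilterLemma eventually_filter.
by exists (exist _ G (inhabits UG)) => A; exact: ooG.
Qed.

Lemma bohr_bump (R : realType) (K : topologicalZmodType) (a : nat -> K)
  (U : set K) (n0 : nat) :
  compact [set: K] -> (forall m n : nat, a (m + n)%N = a m + a n) ->
  open U -> U (a n0) ->
  exists (phi : nat -> R) (c0 : R), [/\ 0 < c0, forall n, 0 <= phi n <= 1,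
    forall n, phi n != 0 -> U (a n) & bohr_positive n0 c0 phi].
Proof.
move=> Kc aD Uo Ua0.
have [D [V [DV VU]]] := finite_coloring Kc Uo Ua0.
have /choice [col colP] : forall n, exists s, s \in D /\ V s (a n).
  by move=> n; have [s sD Vs] := DV (a n); exists s.
have D0 : (0 < #|` D|)%N.
  by rewrite cardfs_gt0; apply/fset0Pn; exists (col 0%N); case: (colP 0%N).
have /choice [s sP] : forall M, exists s,
    (M <= #|` D| * count (fun n => col n == s) (iota 0 M))%N.
  by move=> M; apply: popular_color => n; case: (colP n).
pose A M := [seq n <- iota 0 M.+1 | col n == s M.+1].
pose L M := (4 * M.+1)%N.
have AM M x : x \in A M -> (x < M.+1)%N.
  by rewrite mem_filter mem_iota add0n => /and3P[].
have AL M : {in A M, forall x, (x < L M)%N}.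
  by move=> x /AM; rewrite /L; lia.
have uA M : uniq (A M) by rewrite filter_uniq ?iota_uniq.
have AV M x : x \in A M -> V (s M.+1) (a x).
  by rewrite mem_filter => /andP[/eqP <- _]; case: (colP x).
have L0 M : (0 < L M)%N by [].
(* A popular colour fills at least [1 / #|D|] of the first [M.+1] integers, a quarter of Z/L. *)
pose delta : R := (4 * #|` D|%:R)^-1.
have delta0 : 0 < delta by rewrite invr_gt0 mulr_gt0 // ltr0n.
pose den M : R := ((size (A M))%:R / (L M)%:R) ^+ 4.
have den_ge M : delta ^+ 4 <= den M.
  rewrite /den lerXn2r ?nnegrE ?(ltW delta0) ?divr_ge0 //.
  rewrite ler_pdivlMr ?ltr0n // /delta mulrC ler_pdivrMr ?mulr_gt0 ?ltr0n //.
  rewrite -!natrM ler_nat /L mulnCA mulnC [X in (_ <= X)%N]mulnC.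
  by rewrite leq_mul2r mulnC /= size_filter; exact: sP.
have den_le M : den M <= 1.
  rewrite /den exprn_ile1 ?divr_ge0 // ler_pdivrMr ?ltr0n // mul1r ler_nat.
  by rewrite -[L M](size_iota 0) uniq_leq_size // => x /AL; rewrite mem_iota.
pose r n M := corr R (L M) n0 (A M) n.
have r01 n M : 0 <= r n M <= 1.
  apply/andP; split; first exact: corr_ge0.
  by apply: corr_le1; [exact: L0|exact: uA|exact: AL].
have br n : bounded_seq (r n).
  by exists 1 => M; have /andP[r0 r1] := r01 n M; rewrite ger0_norm.
have [q qoo] := ultrafilter_oo.
have bden : bounded_seq den.
  by exists 1 => M; rewrite ger0_norm // exprn_ge0 // divr_ge0.
exists (fun n => ulim q (r n)), (ulim q den); split.
- apply: (@lt_le_trans _ _ (delta ^+ 4)); first by rewrite exprn_gt0.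
  apply: (@ulim_closed _ q den [set x | delta ^+ 4 <= x] bden).
    exact: closed_ge.
  by apply: nearW => M; exact: den_ge.
- move=> n; have := @ulim_closed _ q (r n) `[0, 1]%classic (br n).
  rewrite /= in_itv /=; apply; first exact: interval_closed.
  by apply: nearW => M /=; rewrite in_itv; exact: r01.
- move=> n; apply: contra_neqP => nU; rewrite -(@ulim_cst R q 0).
  (* Once [M] is at least [n] and [n0], a positive [r n M] would write [a n] as [a n0] plus two
     differences within one colour class, hence inside [U]. *)
  apply: near_ulim; apply: qoo; exists (maxn n n0) => // M /=.
  rewrite geq_max => /andP[nM n0M].
  have /andP[+ _] := r01 n M; rewrite le_eqVlt => /predU1P[//|].
  move=> rpos; have [x [y [z [w [[xA yA zA wA] e]]]]] :=
    corr_gt0 (erefl (4 * M.+1)%N) nM n0M (@AM M) rpos.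
  case: nU.
  have -> : a n = a n0 + (a x - a y) + (a z - a w).
    have : a (n + y + w)%N = a (n0 + x + z)%N by rewrite e.
    rewrite !aD => e'; rewrite -(addrK (a y + a w) (a n)) [a n + _]addrA e'.
    by rewrite opprD !addrA [a n0 + a x + a z - a y]addrAC.
  by apply: VU; apply: AV; eassumption.
move=> tau tau0.
(* The number [k] of terms depends on [tau] only, so coefficients and frequencies can be passed to
   the limit one by one. *)
have [k hk] : exists k : nat, tau^-1 <= k%:R.
  by exists (Num.bound tau^-1); apply/ltW/archi_boundP; rewrite invr_ge0 ltW.
have /choice [c /choice [th cth]] : forall M, exists c th : nat -> R,
    [/\ forall i, 0 <= c i <= 1, forall i, 0 <= th i <= 1 &
    forall n, `|r n M - (den M +
      \sum_(i < k) c i * cos (2 * pi * (n%:R - n0%:R) * th i))| <= tau].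
  by move=> M; apply: corr_approx; [exact: L0|exact: uA|exact: AL| |].
have c01 M i : 0 <= c M i <= 1 by case: (cth M).
have th01 M i : 0 <= th M i <= 1 by case: (cth M).
have bnd01 (u : nat -> R) : (forall M, 0 <= u M <= 1) -> bounded_seq u.
  by move=> hu; exists 1 => M; have /andP[u0 u1] := hu M; rewrite ger0_norm.
have lim01 (u : nat -> R) : (forall M, 0 <= u M <= 1) -> 0 <= ulim q u <= 1.
  move=> hu; have := @ulim_closed _ q u `[0, 1]%classic (bnd01 u hu).
  rewrite /= in_itv /=; apply; first exact: interval_closed.
  by apply: nearW => M /=; rewrite in_itv; exact: hu.
exists k, (fun i => ulim q (c ^~ i)), (fun i => ulim q (th ^~ i)); split.
- by move=> i; apply: lim01.
- by move=> i; apply: lim01.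
move=> n.
have cv : r n M - (den M +
      \sum_(i < k) c M i * cos (2 * pi * (n%:R - n0%:R) * th M i)) @[M --> sval q]
   --> ulim q (r n) - (ulim q den +
      \sum_(i < k) ulim q (c ^~ i) *
        cos (2 * pi * (n%:R - n0%:R) * ulim q (th ^~ i))).
  apply: cvgB; first exact: ulim_cvg.
  apply: cvgD; first exact: ulim_cvg.
  apply: (cvg_big add_continuous) => i _.
  apply: cvgM; first by apply: ulim_cvg; exact: bnd01.
  apply: continuous_cvg; first exact: continuous_cos.
  by apply: cvgMl_tmp; apply: ulim_cvg; exact: bnd01.
apply: (closed_cvg [set y : R | y <= tau] (@closed_le R tau) _ _ (cvg_norm cv)).
by apply: nearW => M /=; case: (cth M).
Qed.

(** * Measures on beta N *)

Lemma near_limn_einf_ge (R : realType) (u : (\bar R)^nat) (l : \bar R) :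
  (\forall n \near \oo, l <= u n)%E -> (l <= limn_einf u)%E.
Proof.
move=> [N _ Nu]; rewrite limn_einf_lim; apply: lime_ge.
  exact: is_cvg_einfs.
exists N => // n /= Nn; apply: le_ereal_inf_tmp => _ [m /= nm <-].
by apply: Nu; exact: leq_trans nm.
Qed.

(** The limsup is an infimum of suprema over tails, so some tail already has a negative supremum. *)
Lemma limn_esup_lt0 (R : realType) (u : nat -> R) :
  (limn_esup (fun n => (u n)%:E) < 0)%E ->
  exists2 e : R, 0 < e & \forall n \near \oo, u n <= - e.
Proof.
move=> /ereal_inf_lt [_ [V ooV <-] sV].
have [r [r0 sr]] : exists r : R, r < 0 /\
    (ereal_sup ((fun n => (u n)%:E) @` V) <= r%:E)%E.
  case: (ereal_sup _) sV => [r|//|_]; first by rewrite lte_fin; exists r.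
  by exists (-1); split; [lra|exact: leNye].
exists (- r); first lra.
apply: filterS ooV => n Vn; rewrite opprK -lee_fin (le_trans _ sr) //.
by apply: ereal_sup_ubound; exists n.
Qed.

Section ReverseFatou.
Context d (T : measurableType d) (R : realType) (mu : probability T R).
Variables (g : nat -> T -> R) (C : R) (S : set T).
Hypotheses (mg : forall n, measurable_fun setT (g n))
  (gC : forall n x, `|g n x| <= C)
  (ig : forall n, (\int[mu]_x (g n x)%:E = 0)%E)
  (S0 : mu.-negligible S)
  (gS : forall x, ~ S x -> \forall n \near \oo, g n x <= 0).

Let integrableg n : mu.-integrable setT (EFin \o g n).
Proof.
apply: measurable_bounded_integrable => //.
  by rewrite (le_lt_trans (probability_le1 _ _)) ?ltry.
exists C; split; first exact: num_real.
by move=> M CM x _; rewrite /= (le_trans (gC n x)) // ltW.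
Qed.

Let integral_C : (\int[mu]_x C%:E = C%:E)%E.
Proof.
apply: etrans (integral_cst mu measurableT C%:E) _.
by apply: etrans (mule1 _); congr (_ * _)%E; exact: probability_setT.
Qed.

Let measurable_eventually_le (e : R) (j : nat) :
  measurable [set x | forall n, (j <= n)%N -> g n x <= - e].
Proof.
rewrite (_ : [set x | _] =
    \bigcap_(n in [set n | (j <= n)%N]) [set x | g n x <= - e]).
  apply: bigcap_measurable => [|n _]; first by exists j => /=.
  rewrite -[X in measurable X]setTI.
  exact: (measurable_fun_le measurableT (mg n) (measurable_cst _)).
by apply/seteqP; split => x /=.
Qed.

(* Fatou's lemma for [C - g n]. *)
Lemma measure_eventually_le (e : R) (j : nat) : 0 < e ->
  mu [set x | forall n, (j <= n)%N -> g n x <= - e] = 0%E.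
Proof.
move=> e0; set E := [set x | _].
have mE : measurable E by exact: measurable_eventually_le.
pose L x := limn_einf (fun n => (C - g n x)%:E).
pose Cg n (x : T) : R := C - g n x.
have mCg n : measurable_fun setT (EFin \o Cg n).
  by apply/measurable_EFinP; apply: measurable_funB => //.
have Cg0 n x : (0 <= (C - g n x)%:E)%E.
  by rewrite lee_fin subr_ge0 (le_trans (ler_norm _)).
have iCg n : (\int[mu]_x (C - g n x)%:E = C%:E)%E.
  under eq_integral do rewrite EFinB.
  rewrite (integralB_EFin measurableT
    (finite_measure_integrable_cst mu C measurableT) (integrableg n)).
  by rewrite ig sube0; exact: integral_C.
have LC : (\int[mu]_x L x <= C%:E)%E.
  apply: (le_trans (fatou mu measurableT mCg (fun n x _ => Cg0 n x))).
  rewrite (_ : (fun n => _) = cst C%:E); last by apply/funext => n; rewrite iCg.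
  by rewrite (cvg_limn_einf_sup (cvg_cst C%:E)).1.
have mL : measurable_fun setT L.
  rewrite /L /limn_einf; apply: measurableT_comp => //.
  apply: measurable_fun_limn_esup => n.
  by apply: measurableT_comp => //; exact: mCg.
have C0 : 0 <= C by rewrite (le_trans _ (gC 0%N point)).
(* Almost everywhere [g n x] is eventually at most 0, and on [E] at most [- e]; against the bound
   [LC] this leaves no room for [mu E > 0]. *)
have LE : (\int[mu]_x (C + e * \1_E x)%:E <= \int[mu]_x L x)%E.
  apply: ae_ge0_le_integral => //.
  - by move=> x _; rewrite lee_fin addr_ge0 // mulr_ge0 // ltW.
  - apply/measurable_EFinP; apply: measurable_funD => //.
    by apply: measurable_funM => //; exact: measurable_indic.
  - by move=> x _; apply: near_limn_einf_ge; exact: nearW.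
  case: S0 => N [mN N0 SN]; exists N; split => // x /= nx.
  apply: contrapT => Nx; apply: nx => _; apply: near_limn_einf_ge.
  rewrite indicE; have [|] := boolP (x \in E); rewrite ?inE => Ex.
    by exists j => // n /= jn; have := Ex n jn; rewrite lee_fin /= mulr1; lra.
  have : ~ S x by move=> /SN.
  by move=> /gS; apply: filterS => n; rewrite lee_fin /= mulr0; lra.
have := le_trans LE LC.
under eq_integral do rewrite EFinD EFinM.
have mI : measurable_fun setT (EFin \o (\1_E : T -> R)).
  by apply/measurable_EFinP; exact: measurable_indic.
have I0 x : setT x -> (0 <= (\1_E x : R)%:E)%E by rewrite lee_fin.
rewrite (ge0_integralD mu measurableT (fun x _ => _ : 0 <= C%:E)%E) //; last 2 first.
- by move=> x _; rewrite mule_ge0 ?I0 // lee_fin ltW.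
- exact: measurable_funeM.
rewrite integral_C (ge0_integralZl_EFin mu measurableT I0 mI (ltW e0)).
rewrite integral_indic // setIT -[leRHS]adde0 leeD2lE // => h.
apply/eqP; rewrite eq_le measure_ge0 andbT.
by move: h; rewrite pmule_rle0 ?lte_fin.
Qed.

Lemma negligible_eventually_lt0 (B : set T) :
  (forall x, B x -> S x \/ exists2 e, 0 < e & \forall n \near \oo, g n x <= - e) ->
  mu.-negligible B.
Proof.
move=> hB.
apply: (@negligibleS _ _ _ _ (S `|` \bigcup_j
  [set x | forall n, (j <= n)%N -> g n x <= - j.+1%:R^-1])).
  move=> x /hB [Sx|[e e0 [N _ hN]]]; [by left|right].
  pose k := Num.bound e^-1.
  (* A single index serves both as starting time and as threshold [j.+1%:R^-1]. *)
  exists (maxn N k) => // n; rewrite geq_max => /andP[Nn kn].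
  rewrite (le_trans (hN n Nn)) // lerN2 -[leRHS]invrK lef_pV2 ?posrE ?invr_gt0 //.
  have /ltW := archi_boundP (ltW (etrans (invr_gt0 e) e0)).
  by move/le_trans; apply; rewrite ler_nat -/k (leq_trans (leq_maxr N k)).
apply: negligibleU => //; apply: negligible_bigcup => j.
apply/negligibleP; first exact: measurable_eventually_le.
by apply: measure_eventually_le; rewrite invr_gt0 ltr0n.
Qed.

End ReverseFatou.

Section MeasuresOnBetaN.
Variables (R : realType) (Psi : nat -> {fset nat}).
Implicit Types u : nat -> R.

Lemma measurable_clN (A : set nat) : measurable (clN A : set betaN_borel).
Proof. by apply: sub_sigma_algebra; exact: open_clN. Qed.

Lemma measurable_ulim u : bounded_seq u ->
  measurable_fun setT ((fun p => ulim p u) : betaN_borel -> R).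
Proof.
move=> bu; apply: (measurability _ (RGenOpens.measurableE R)).
move=> _ [_ [a [b ->]] <-]; rewrite setTI; apply: sub_sigma_algebra.
by move/continuousP : (continuous_ulim bu); apply; exact: interval_open.
Qed.

Lemma ulim_favg (p : betaN) (h : nat -> R) (f : nat -> nat -> R) N :
  (forall m, bounded_seq (f m)) ->
  ulim p (fun n => favg Psi N (fun m => h m * f m n)) =
  favg Psi N (fun m => h m * ulim p (f m)).
Proof.
move=> bf; apply: ulimE; apply: cvgMl_tmp; apply: (cvg_big add_continuous) => m _.
by apply: cvgMl_tmp; exact: ulim_cvg.
Qed.

Variable mu : probability betaN_borel R.
Hypothesis mu_MPsi : in_MPsi Psi mu.

Lemma MPsi_favg u (e : R) (A : set nat) : bounded_seq u -> 0 < e ->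
  (\forall N \near \oo, A N) -> exists2 N, A N &
  `|fine (\int[mu]_(p in [set: betaN_borel]) (ulim p u)%:E) - favg Psi N u| < e.
Proof.
move=> bu e0 [N0 _ AN]; have [N N0N] := mu_MPsi.2 1%N (fun _ p => ulim p u)
  (fun _ => continuous_ulim bu) e e0 N0.
move=> /(_ ord0) hN; exists N; first exact: AN.
have eu : (fun n => ulim (principal_uf n) u) = u.
  by apply/funext => n; exact: ulim_principal.
by move: hN; rewrite /= eu.
Qed.

(** The integral is a cluster value of the averages of [u], so it equals their limit when they
    converge. *)
Lemma integral_ulim u (l : R) : bounded_seq u ->
  favg Psi N u @[N --> \oo] --> l ->
  (\int[mu]_(p in [set: betaN_borel]) (ulim p u)%:E = l%:E)%E.
Proof.
move=> bu ul; rewrite -[LHS]fineK; last first.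
  apply: integrable_fin_num => //; apply: measurable_bounded_integrable => //.
  - by rewrite (le_lt_trans (probability_le1 _ _)) ?ltry.
  - exact: measurable_ulim.
  have [C uC] := bu; exists C; split; first exact: num_real.
  by move=> M CM p _; rewrite /= (le_trans (norm_ulim _ uC)) // ltW.
congr EFin; apply/eqP; rewrite -subr_eq0 -normr_eq0 eq_le normr_ge0 andbT.
apply/ler_addgt0Pl => e e0; rewrite addr0.
have e2 : 0 < e / 2 by lra.
move/cvgrPdist_le : ul => /(_ _ e2) ul.
have [N hN1 hN2] := MPsi_favg bu e2 ul.
rewrite [leRHS](_ : e = e / 2 + e / 2); last by lra.
rewrite -(subrKA (favg Psi N u)) (le_trans (ler_normD _ _)) // lerD //.
  exact: ltW.
by rewrite distrC.
Qed.

End MeasuresOnBetaN.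

(** * Measurability and positive measure of the set [S] *)

Section Main.
Variables (R : realType) (Psi : nat -> {fset nat}) (f h : nat -> R).
Variable B : set nat.
Let S : set betaN_borel := [set p : betaN | clN B p /\
  (0 <= limn_esup (fun N =>
    (favg Psi N (fun m => h m * Rshift p f m))%:E))%E].
Hypotheses (f_bounded : bounded_seq f) (h_bounded : bounded_seq h).

Lemma shift_bounded m : bounded_seq (fun n => f (m + n)%N).
Proof. by case: f_bounded => M hM; exists M. Qed.

Lemma measurable_limsup_ge0 : measurable S.
Proof.
rewrite (_ : S = clN B `&` (setT `&` [set p : betaN_borel | (0 <= limn_esup
    (fun N => (favg Psi N (fun m => h m * Rshift p f m))%:E))%E])); last first.
  by rewrite setTI.
apply: measurableI; first exact: measurable_clN.
apply: emeasurable_fun_c_infty => //; apply: measurable_fun_limn_esup => N.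
apply/measurable_EFinP; apply: measurable_funM => //.
apply: measurable_sum => m; apply: measurable_funM => //.
by apply: measurable_ulim; exact: shift_bounded.
Qed.

Hypotheses (Psi_folner : folner R Psi) (f_perp : bes_perp Psi f).
Variables (phi : nat -> R) (n0 : nat) (c0 : R).
Hypotheses (c0_gt0 : 0 < c0) (phi01 : forall n, 0 <= phi n <= 1)
  (phiB : forall n, phi n != 0 -> B n) (phi_pos : bohr_positive n0 c0 phi).
Variable mu : probability betaN_borel R.
Hypothesis mu_MPsi : in_MPsi Psi mu.
Let Psi0 : forall N, Psi N != fset0 := Psi_folner.1.

Let norm_phi n : `|phi n| <= 1.
Proof. by have /andP[p0 p1] := phi01 n; rewrite ger0_norm. Qed.

Let phi_bounded : bounded_seq phi.
Proof. by exists 1. Qed.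

Let u N n : R := phi n * favg Psi N (fun m => h m * f (m + n)%N).

Let u_bounded : exists C, forall N n, `|u N n| <= C.
Proof.
have [Mf hMf] := f_bounded; have [Mh hMh] := h_bounded.
exists (1 * (Mh * Mf)) => N n; rewrite normrM ler_pM //.
by apply: norm_favg => // m; rewrite normrM ler_pM.
Qed.

Let ulim_u N p :
  ulim p (u N) = ulim p phi * favg Psi N (fun m => h m * Rshift p f m).
Proof.
rewrite ulimM //; first by rewrite ulim_favg //; exact: shift_bounded.
have [Mf hMf] := f_bounded; have [Mh hMh] := h_bounded.
exists (Mh * Mf) => n; apply: norm_favg => // m; by rewrite normrM ler_pM.
Qed.

(** Exchanging the two finite averages leaves, for each [m] in [Psi N], an average of
    [f (n + m) * phi n], which tends to 0. *)
Let cvg_favg_u N : favg Psi N' (u N) @[N' --> \oo] --> (0 : R).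
Proof.
rewrite (_ : (fun N' => _) = fun N' => favg Psi N (fun m => h m *
    favg Psi N' (fun n => f (n + m)%N * phi n))); last first.
  apply/funext => N'; rewrite /u /favg.
  move: (_^-1) (_^-1) => c c'.
  transitivity (\sum_(n <- Psi N') \sum_(m <- Psi N)
      c * c' * (h m * f (n + m)%N * phi n)).
    rewrite mulr_sumr; apply: eq_bigr => n _; rewrite !mulr_sumr.
    by apply: eq_bigr => m _; rewrite addnC; ring.
  rewrite exchange_big mulr_sumr; apply: eq_bigr => m _; rewrite !mulr_sumr.
  by apply: eq_bigr => n _; ring.
rewrite [X in _ --> X](_ : 0 = favg Psi N (fun m => h m * 0)); last first.
  by rewrite /favg big1 ?mulr0 // => m _; rewrite mulr0.
apply: cvgMl_tmp; apply: (cvg_big add_continuous) => m _.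
by apply: cvgMl_tmp; exact: cvg_favg_perp_bohr phi_pos.
Qed.

Lemma limsup_ge0_gt0 : (0 < mu S)%E.
Proof.
have [C uC] := u_bounded; rewrite lt_neqAle measure_ge0 andbT.
apply/negP => /eqP S0.
(* A nonzero limit of [phi] puts [p] in [clN B], so [p] can miss [S] only through a negative
   limsup. *)
have phi_neg p : ~ S p -> ulim p phi != 0 ->
    exists2 e, 0 < e & \forall N \near \oo, ulim p (u N) <= - e.
  move=> nS phi0.
  have Bp : clN B p by apply: contrapT => /(ulim_notin phiB)/eqP; exact/negP.
  have phi_ge0 : 0 <= ulim p phi.
    apply: (@ulim_closed _ p phi [set x | 0 <= x] phi_bounded).
      exact: closed_ge.
    by apply: nearW => n; case/andP: (phi01 n).
  have phi_gt0 : 0 < ulim p phi by rewrite lt_neqAle eq_sym phi0.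
  have : (limn_esup (fun N =>
      (favg Psi N (fun m => h m * Rshift p f m))%:E) < 0)%E.
    by rewrite ltNge; apply/negP => ?; apply: nS.
  move=> /limn_esup_lt0 [e e0 he]; exists (ulim p phi * e); first exact: mulr_gt0.
  by apply: filterS he => N hN; rewrite ulim_u -mulrN ler_wpM2l.
have buN N : bounded_seq (u N) by exists C.
have nS0 : mu.-negligible S by apply/negligibleP => //; exact: measurable_limsup_ge0.
have null : mu.-negligible [set p : betaN_borel | ulim p phi != 0].
  apply: (@negligible_eventually_lt0 _ _ _ mu (fun N p => ulim p (u N)) C S) => //.
  - by move=> N; exact: measurable_ulim.
  - by move=> N p; apply: norm_ulim.
  - by move=> N; exact: (integral_ulim mu_MPsi (buN N) (@cvg_favg_u N)).
  - move=> p nSp; have [p0|p0] := eqVneq (ulim p phi) 0.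
      by apply: nearW => N; rewrite ulim_u p0 mul0r.
    have [e e0] := phi_neg p nSp p0; apply: filterS => N /le_trans; apply.
    by rewrite oppr_le0 ltW.
  - move=> p /= p0; have [Sp|nSp] := pselect (S p); [by left|right].
    exact: phi_neg.
have i0 : (\int[mu]_(p in [set: betaN_borel]) (ulim p phi)%:E = 0)%E.
  rewrite (ae_eq_integral (cst 0%E)) ?integral0 //.
    by apply/measurable_EFinP; exact: measurable_ulim.
  apply: negligibleS null => p /= np; apply/negP => /eqP p0; apply: np.
  by rewrite p0.
(* The averages of [phi] are eventually at least [c0 / 2], yet some such average is within less than
   [c0 / 2] of the integral 0. *)
have c2 : 0 < c0 / 2 by exact: divr_gt0.
have c21 : c0 / 2 < c0 by rewrite ltr_pdivrMr // mulr_natr mulr2n ltrDl.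
have [N hN] := MPsi_favg mu_MPsi phi_bounded c2
  (near_favg_bohr Psi_folner phi_pos c21).
by rewrite i0 /= sub0r normrN ltNge (le_trans hN (ler_norm _)).
Qed.

End Main.

Theorem theorem4p11 (R : realType) (Psi : nat -> {fset nat}) (f : nat -> R) :
  folner R Psi -> bounded_seq f -> bes_perp Psi f ->
  forall (B : set nat) (h : nat -> R),
    bohr_set R B -> B !=set0 -> bounded_seq h ->
    let S : set betaN_borel :=
      [set p : betaN | clN B p /\
         (0 <= limn_esup (fun N =>
                 (favg Psi N (fun m => h m * Rshift p f m))%:E))%E] in
    measurable S /\
    forall mu : probability betaN_borel R, in_MPsi Psi mu -> (0 < mu S)%E.
Proof.
move=> Psi_folner f_bounded f_perp B h Bohr [n0 Bn0] h_bounded S.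
split=> [|mu mu_MPsi]; first exact: measurable_limsup_ge0.
case: Bohr => K [a [U [lam [[Kc _ aD _] [Uo _ _ BU]]]]].
have Un0 : U (a n0) by rewrite BU in Bn0.
have [phi [c0 [c0_gt0 phi01 phiU phi_pos]]] := @bohr_bump R _ _ _ _ Kc aD Uo Un0.
apply: (@limsup_ge0_gt0 _ _ _ _ _ _ _ _ _ phi n0 c0) => // n.
by rewrite BU; exact: phiU.
Qed.
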